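(* Let $\mathcal{P}$ and $\mathcal{P}_0$ be palettes. There exists a hypergraph that is $\mathcal{P}$-colorable but not $\mathcal{P}_0$-colorable if and only if there is no homomorphism from $\mathcal{P}$ to $\mathcal{P}_0$ and no homomorphism from $\mathcal{P}$ to $\mathrm{inv}(\mathcal{P}_0)$.
   Context: All hypergraphs are finite and $3$-uniform. A palette $\mathcal{P}=(C,T)$ consists of a finite nonempty set $C$ of colors and a set $T\subseteq C^3$ of feasible triples. A hypergraph $H$ is $\mathcal{P}$-colorable if there exist a linear order $\preceq$ on $V(H)$ and a coloring $c$ of the $2$-element subsets of $V(H)$ by colors from $C$ such that for every edge $\{u,v,w\}$ with $u\prec v\prec w$ we have $(c(uv),c(uw),c(vw))\in T$. The inverse palette $\mathrm{inv}(\mathcal{P})=(C,T')$ has $(x,y,z)\in T'$ iff $(z,y,x)\in T$. A homomorphism from $(C,T)$ to $(C',T')$ is a map $f:C\to C'$ with $(f(x),f(y),f(z))\in T'$ for all $(x,y,z)\in T$. *)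

(* Defs.v *)
From HB Require Import structures.
From mathcomp Require Import all_boot all_order.

Set Implicit Arguments.
Unset Strict Implicit.
Unset Printing Implicit Defensive.

Record palette := Palette {
  color : finType;
  feasible : {set color * color * color};
  color_nonempty : 0 < #|color|
}.

Record hypergraph := Hypergraph {
  vertex : finType;
  edges : {set {set vertex}};
  edges_3uniform : forall e, e \in edges -> #|e| = 3
}.

Definition linear_order (T : eqType) (le : rel T) : Prop :=
  [/\ reflexive le, antisymmetric le, transitive le & total le].

Definition strict (T : eqType) (le : rel T) : rel T :=
  fun u v => (u != v) && le u v.

(* [c] is total on sets of vertices, but only its values on 2-element sets
   are used; since a palette has a color, every coloring of the 2-element sets
   is the restriction of such a [c]. *)
Definition colorable (P : palette) (H : hypergraph) : Prop :=
  exists (le : rel (vertex H)) (c : {set vertex H} -> color P),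
    linear_order le /\
    forall u v w : vertex H,
      [set u; v; w] \in edges H -> strict le u v -> strict le v w ->
      (c [set u; v], c [set u; w], c [set v; w]) \in feasible P.

Definition inv_palette (P : palette) : palette :=
  @Palette (color P)
    [set t : color P * color P * color P |
       let: (x, y, z) := t in (z, y, x) \in feasible P]
    (color_nonempty P).

Definition is_hom (P P' : palette) (f : color P -> color P') : Prop :=
  forall x y z : color P,
    (x, y, z) \in feasible P -> (f x, f y, f z) \in feasible P'.

Definition has_hom (P P' : palette) : Prop :=
  exists f : color P -> color P', is_hom f.

(* Main.v *)
Require Import Defs.
From mathcomp Require Import all_boot all_order zify.

Set Implicit Arguments.
Unset Strict Implicit.
Unset Printing Implicit Defensive.

(** A homomorphism to [P0] or to its inverse turns [P]-colorings into
    [P0]-colorings, after reversing the order in the second case.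

    Conversely, take vertices [(i, a)] with [i < N] and [a < M], and give a pair
    [(i, a), (j, b)] with [i < j] the color [g a b], where [g] is a random
    [M x M] matrix: every not too small submatrix contains all colors. The
    hypergraph consists of the triangles that are feasible in [P]. A
    [P0]-coloring labels each pair by its new color and by whether the new order
    agrees with that of the parts. Shrinking the parts, we may assume that for
    parts [i < j], an old color and a label, either no pair has both or such a
    pair occurs between any two large subsets. In the latter case we choose the
    label, so that [i < j] yields a function from colors to labels; by Ramsey's
    theorem some three parts [i < j < k] yield the same function [f]. Greedy
    embedding finds between these parts a triangle with any prescribed colors
    and the labels [f] assigns to them. Hence the direction in [f] is constant,
    and [f] is a homomorphism to [P0] or to its inverse. *)

(** * Elementary counting and growth estimates *)

Lemma exists_subset_card (T : finType) (A : {set T}) n :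
  n <= #|A| -> exists2 B : {set T}, B \subset A & #|B| = n.
Proof.
move=> le_nA; exists [set x in take n (enum A)].
  by apply/subsetP=> x; rewrite inE => /mem_take; rewrite mem_enum.
rewrite cardsE (card_uniqP _) ?take_uniq ?enum_uniq // size_takel //.
by rewrite -cardE.
Qed.

Lemma leq_card_bigcup (I T : finType) (A : {pred I}) (F : I -> {set T}) :
  #|\bigcup_(i in A) F i| <= \sum_(i in A) #|F i|.
Proof.
elim/big_rec2: _ => [|i n U _ le_Un]; first by rewrite cards0.
by apply: leq_trans (leq_card_setU _ _) _; rewrite leq_add2l.
Qed.

Lemma linear_le_exp2 (a b : nat) : exists n, a * n + b <= 2 ^ n.
Proof.
(* With [n = 2 * c], [2 ^ n] is at least [(c + 1) ^ 2], where [c ^ 2] dominates [a * n] and [2 * c]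
   dominates [b]. *)
set c := 2 * a + b; exists (2 * c); rewrite mul2n -addnn expnD.
have lt_c : c < 2 ^ c by apply: ltn_expl.
have := leq_mul lt_c lt_c; rewrite /c; nia.
Qed.

(** Bernoulli's inequality bounds [q ^ q] below by [(q - 1) ^ q + q * (q - 1) ^ (q - 1)], whose last
    term is at least [(q - 1) ^ q]. *)
Lemma double_pred_exp q : 0 < q -> 2 * q.-1 ^ q <= q ^ q.
Proof.
case: q => // q _ /=; rewrite expnS [in leqRHS]expnS.
have bern n : q ^ n.+1 + n.+1 * q ^ n <= q.+1 ^ n.+1.
  elim: n => [|n IH]; first by rewrite !expn1 expn0; lia.
  rewrite [q.+1 ^ _]expnS; apply: leq_trans (leq_mul (leqnn _) IH).
  by rewrite !expnS; move: (q ^ n) => X; nia.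
have := bern q; rewrite !expnS; move: (q ^ q) (q.+1 ^ q) => X Y; lia.
Qed.

Lemma card_avoiding_colorings (T C : finType) (D : {set T}) (z : C) :
  #|[set g : {ffun T -> C} | [forall p in D, g p != z]]| =
  #|C|.-1 ^ #|D| * #|C| ^ (#|T| - #|D|).
Proof.
pose F p := if p \in D then predC1 z else predT.
rewrite cardsE (eq_card (B := family F)); last first.
  move=> g; rewrite !inE; apply: eq_forallb => p.
  by rewrite /F /finfun.fmem /=; case: (p \in D).
rewrite card_family foldrE big_map big_enum /=.
rewrite (bigID (mem D)) /=; congr (_ * _).
  rewrite -prod_nat_const; apply: eq_bigr => p; rewrite /F => ->.
  by rewrite cardC1.
have -> : #|T| - #|D| = #|~: D| by rewrite [#|~: D|]cardsCs setCK.
rewrite -prod_nat_const.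
apply: eq_big => [p|p]; first by rewrite inE.
by rewrite /F => /negPf ->.
Qed.

(** Union bound for random matrices: there are at most [M ^ t * M ^ t * q] choices of two [t]-sets
    and a color, each color being avoided with probability [((q - 1) / q) ^ (t * t)], while [M] is
    only polynomial in [t]. *)
Lemma generic_matrix_bound q e : 0 < q ->
  exists2 t, 0 < t & forall M, M = t.+1 ^ e ->
    M ^ t * M ^ t * q * q.-1 ^ (t * t) < q ^ (t * t).
Proof.
move=> q_gt0; have [b le_b] := linear_le_exp2 (2 * e) ((q + 1) * (2 * e) + 1).
set s := 2 ^ b in le_b; have s_gt0 : 0 < s by rewrite expn_gt0.
(* As [q] divides [t], the exponent [t * t] splits into [q * s * s] blocks of length [q], each
   gaining a factor 2 by [double_pred_exp]. *)
exists (q * s) => [|M ->]; first by rewrite muln_gt0 q_gt0.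
set t := q * s.
have [->|q1_gt0] := posnP q.-1.
  by rewrite exp0n ?muln0 ?expn_gt0 ?q_gt0 // !muln_gt0 q_gt0 s_gt0.
have tt : t * t = q * (q * s * s) by rewrite /t; lia.
have le_q : 2 ^ (q * s * s) * q.-1 ^ (t * t) <= q ^ (t * t).
  rewrite tt (expnM q) (expnM q.-1) -expnMn leq_exp2r ?double_pred_exp //.
  by rewrite !muln_gt0 q_gt0 s_gt0.
apply: leq_trans le_q; rewrite ltn_pmul2r ?expn_gt0 ?q1_gt0 //.
have le_t : t.+1 <= 2 ^ (q + 1 + b).
  rewrite !expnD expn1 -/s /t; have := ltn_expl q (ltnSn 1); nia.
have le_M : (t.+1 ^ e) ^ t * (t.+1 ^ e) ^ t <= 2 ^ ((q + 1 + b) * (2 * e * t)).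
  rewrite -expnD -expnM [in leqRHS]expnM.
  rewrite (_ : e * (t + t) = 2 * e * t); last by lia.
  by have [->|?] := posnP (2 * e * t); rewrite ?expn0 // leq_exp2r.
apply: leq_ltn_trans (leq_mul le_M (leqnn q)) _.
apply: (@leq_trans (2 ^ ((q + 1 + b) * (2 * e * t)) * 2 ^ q)).
  by rewrite ltn_pmul2l ?expn_gt0 // ltn_expl.
rewrite -expnD leq_exp2l //.
have le1 : (q + 1 + b) * (2 * e) + 1 <= s by lia.
have := leq_mul (leqnn (q * s)) le1; rewrite /t; nia.
Qed.

(** Otherwise the sets of bad matrices cover all matrices, against the union bound. The exponent [e]
    is prescribed so that parts of size [M] can survive repeated shrinking. *)
Lemma generic_matrix (C : finType) e : 0 < #|C| ->
  exists2 t, 0 < t &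
    exists g : 'I_(t.+1 ^ e) -> 'I_(t.+1 ^ e) -> C,
    forall (A B : {set 'I_(t.+1 ^ e)}) z, t <= #|A| -> t <= #|B| ->
      exists a b, [/\ a \in A, b \in B & g a b = z].
Proof.
move=> C_gt0; have [t t_gt0 /(_ _ erefl) bound] := generic_matrix_bound e C_gt0.
exists t => //; set M := t.+1 ^ e in bound *.
pose draws := [set A : {set 'I_M} | #|A| == t].
pose bad (w : {set 'I_M} * {set 'I_M} * C) :=
  [set g : {ffun 'I_M * 'I_M -> C} | [forall p in setX w.1.1 w.1.2, g p != w.2]].
have le_draws : #|draws| <= M ^ t.
  rewrite card_draws card_ord.
  have [le_tM|lt_Mt] := leqP t M; last by rewrite bin_small.
  apply: leq_trans (_ : M ^_ t <= _).
    by rewrite -bin_ffact leq_pmulr ?fact_gt0.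
  rewrite ffact_prod -[X in _ <= _ ^ X]card_ord -prod_nat_const.
  by apply: leq_prod => i _; apply: leq_subr.
(* The factor [#|C| ^ (t * t)] avoids the exponent [M * M - t * t]. *)
have card_bad w : w \in setX (setX draws draws) setT ->
    #|bad w| * #|C| ^ (t * t) = #|C|.-1 ^ (t * t) * #|C| ^ (M * M).
  rewrite !inE => /andP[/andP[/eqP A1 /eqP A2] _].
  rewrite card_avoiding_colorings cardsX A1 A2 card_prod card_ord -mulnA -expnD.
  rewrite subnK //; apply: leq_mul.
    by rewrite -A1 -[X in _ <= X](card_ord M) max_card.
  by rewrite -A1 -[X in _ <= X](card_ord M) max_card.
have [/existsP[g /forallP good]|] := boolP [exists g : {ffun 'I_M * 'I_M -> C},
    [forall w in setX (setX draws draws) setT, g \notin bad w]].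
  exists (fun a b => g (a, b)) => A B z leA leB.
  have [A' sA cA] := exists_subset_card leA.
  have [B' sB cB] := exists_subset_card leB.
  have := good (A', B', z); rewrite !inE /= cA cB eqxx /=.
  case/forall_inPn => -[a b]; rewrite inE /= => /andP[aA bB] /negPn/eqP gz.
  by exists a, b; rewrite (subsetP sA) ?(subsetP sB).
rewrite negb_exists => /forallP allbad.
have cover_bad : [set: {ffun 'I_M * 'I_M -> C}] \subset
    \bigcup_(w in setX (setX draws draws) setT) bad w.
  apply/subsetP=> g _; have /forall_inPn[w wP /negPn gw] := allbad g.
  by apply/bigcupP; exists w.
have := subset_leq_card cover_bad.
rewrite cardsT card_ffun card_prod card_ord => le1.
have le2 : #|\bigcup_(w in setX (setX draws draws) setT) bad w| * #|C| ^ (t * t)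
    <= M ^ t * M ^ t * #|C| * (#|C|.-1 ^ (t * t) * #|C| ^ (M * M)).
  apply: leq_trans (leq_mul (leq_card_bigcup _ _) (leqnn _)) _.
  rewrite big_distrl /= (eq_bigr _ card_bad) sum_nat_const !cardsX cardsT.
  by rewrite leq_mul // leq_mul // leq_mul.
have Cpos k : 0 < #|C| ^ k by rewrite expn_gt0 C_gt0.
have := leq_trans (leq_mul le1 (leqnn (#|C| ^ (t * t)))) le2.
rewrite mulnA mulnC leq_pmul2r // => le3.
by move: bound; rewrite ltnNge le3.
Qed.

(** * Ramsey's theorem for monochromatic triangles *)

Lemma pigeonhole_fiber (I R : finType) (A : {set I}) (D : {set R}) (f : I -> R) m :
  (forall i, i \in A -> f i \in D) -> #|D| * m < #|A| ->
  exists2 d, d \in D & m < #|[set i in A | f i == d]|.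
Proof.
move=> fD lt_mA; apply/exists_inP; apply: contraLR lt_mA => /exists_inPn noD.
rewrite -leqNgt.
have sA : A \subset \bigcup_(d in D) [set i in A | f i == d].
  by apply/subsetP=> i iA; apply/bigcupP; exists (f i); rewrite ?fD // inE iA /=.
apply: leq_trans (subset_leq_card sA) _.
apply: leq_trans (leq_card_bigcup _ _) _.
by rewrite -sum_nat_const; apply: leq_sum => d dD; rewrite leqNgt noD.
Qed.

(** Induction on the number of colors: the least vertex [i] of [A] has many neighbours [B] in one
    color [d]. A pair of color [d] inside [B] closes a triangle with [i]; otherwise [B] only uses
    [D :\ d]. *)
Lemma ramsey_triangle_in (R : finType) n :
  exists m, forall N (chi : 'I_N -> 'I_N -> R) (D : {set R}) (A : {set 'I_N}),
    #|D| <= n -> m <= #|A| ->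
    (forall i j : 'I_N, i \in A -> j \in A -> i < j -> chi i j \in D) ->
    exists i j k : 'I_N, [/\ i < j, j < k, chi i j = chi i k & chi i k = chi j k].
Proof.
elim: n => [|n [m IH]].
  exists 2 => N chi D A; rewrite leqn0 cards_eq0 => /eqP -> /card_gt1P[i [j]].
  case=> iA jA neq_ij chiD; have [lt|] := boolP (i < j).
    by have := chiD i j iA jA lt; rewrite inE.
  rewrite -leqNgt leq_eqVlt (inj_eq val_inj) eq_sym (negPf neq_ij) /= => lt.
  by have := chiD j i jA iA lt; rewrite inE.
(* One extra vertex is [i]; the other makes the pigeonhole inequality strict. *)
exists (n.+1 * m).+2 => N chi D A leD leA chiD.
have [i0 i0A] : exists i, i \in A by apply/card_gt0P; lia.
have [i iA0 min_i] := arg_minnP (fun i : 'I_N => nat_of_ord i) i0A.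
have iA : i \in A := iA0.
have lt_i j : j \in A :\ i -> i < j.
  rewrite !inE => /andP[neq jA]; rewrite ltn_neqAle min_i // andbT.
  by rewrite (inj_eq val_inj) eq_sym.
have [||d dD lt_m] := @pigeonhole_fiber _ _ (A :\ i) D (chi i) m.
- by move=> j jA; apply: chiD (lt_i j jA) => //; case/setD1P: jA.
- move: leA; rewrite (cardsD1 i A) iA !ltnS; apply: leq_ltn_trans.
  by rewrite leq_mul2r leD orbT.
set B := [set j in A :\ i | chi i j == d] in lt_m.
have BP j : j \in B -> [/\ j \in A, i < j & chi i j = d].
  by rewrite inE => /andP[jA /eqP ->]; rewrite lt_i //; case/setD1P: jA.
have [/existsP[j /existsP[k /and4P[jB kB lt_jk /eqP chi_jk]]]|noB] :=
    boolP [exists j, exists k, [&& j \in B, k \in B, j < k & chi j k == d]].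
  have [[_ lt_ij chi_ij] [_ _ chi_ik]] := (BP j jB, BP k kB).
  by exists i, j, k; rewrite lt_ij chi_ij chi_ik chi_jk.
apply: (IH N chi (D :\ d) B); [|exact: ltnW|].
  by move: leD; rewrite (cardsD1 d D) dD; lia.
move=> j k jB kB lt_jk; have [[jA _ _] [kA _ _]] := (BP j jB, BP k kB).
rewrite !inE chiD // andbT; apply: contra noB => chi_jk.
by apply/existsP; exists j; apply/existsP; exists k; apply/and4P.
Qed.

Lemma ramsey_triangle (R : finType) :
  exists N, forall chi : 'I_N -> 'I_N -> R,
    exists i j k : 'I_N, [/\ i < j, j < k, chi i j = chi i k & chi i k = chi j k].
Proof.
have [N ramsey] := ramsey_triangle_in R #|R|; exists N => chi.
by apply: (ramsey N chi setT setT); rewrite ?cardsT ?card_ord //.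
Qed.

(** * Robust relations: greedy embedding and shrinking *)

Section Robust.

Variable T : finType.
Implicit Types (A B D : {set T}) (E : rel T).

Definition robust t A B E :=
  [forall A' : {set T}, forall B' : {set T},
     [&& A' \subset A, B' \subset B, t <= #|A'| & t <= #|B'|] ==>
     [exists a in A', exists b in B', E a b]].

Lemma robustP t A B E :
  reflect (forall A' B', A' \subset A -> B' \subset B ->
             t <= #|A'| -> t <= #|B'| ->
             exists a b, [/\ a \in A', b \in B' & E a b])
          (robust t A B E).
Proof.
apply: (iffP forallP) => [rob A' B' sA sB cA cB|rob A'].
  have /forallP/(_ B')/implyP := rob A'; case/(_ _)/exists_inP; first exact/and4P.
  by move=> a aA /exists_inP[b bB Eab]; exists a, b.
apply/forallP => B'; apply/implyP => /and4P[sA sB cA cB].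
have [a [b [aA bB Eab]]] := rob A' B' sA sB cA cB.
by apply/exists_inP; exists a => //; apply/exists_inP; exists b.
Qed.

(* Otherwise [t] vertices of small degree have fewer than [t ^ 2] neighbours
   in total, and the rest of [B] is large and not joined to them. *)
Lemma robust_few_small_degrees t A B E :
  robust t A B E -> t * t + t <= #|B| ->
  #|[set a in A | #|[set b in B | E a b]| < t]| < t.
Proof.
move=> /robustP rob leB; set S := [set a in A | _].
rewrite ltnNge; apply/negP => /exists_subset_card[S' sS cS].
pose U := \bigcup_(a in S') [set b in B | E a b].
have leU : #|U| <= t * t.
  apply: leq_trans (leq_card_bigcup _ _) _.
  rewrite -{1}cS -sum_nat_const; apply: leq_sum => a /(subsetP sS).
  by rewrite inE => /andP[_ /ltnW].
have [||||a [b [aS]]] := rob S' (B :\: U).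
- by apply: subset_trans sS _; apply/subsetP=> a; rewrite inE => /andP[].
- exact: subsetDl.
- by rewrite cS.
- have := subset_leq_card (subsetIr B U); rewrite cardsD; lia.
rewrite inE => /andP[/negP nU bB] Eab; apply: nU; apply/bigcupP; exists a => //.
by rewrite inE bB.
Qed.

(** Fewer than [2 * t] vertices of [A] have small degree to [B] or [D]. Any other [a] has two
    neighbourhoods of size at least [t], and [E3] joins them. *)
Lemma robust_triangle t A B D E1 E2 E3 :
  robust t A B E1 -> robust t A D E2 -> robust t B D E3 -> 0 < t ->
  2 * t <= #|A| -> t * t + t <= #|B| -> t * t + t <= #|D| ->
  exists a b d, [/\ E1 a b, E2 a d & E3 b d].
Proof.
move=> rob1 rob2 /robustP rob3 t_gt0 cA cB cD.
have small1 := robust_few_small_degrees rob1 cB.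
have small2 := robust_few_small_degrees rob2 cD.
set S1 := [set a in A | _] in small1; set S2 := [set a in A | _] in small2.
have [a] : exists a, a \in A :\: (S1 :|: S2).
  apply/card_gt0P; rewrite cardsD.
  have := subset_leq_card (subsetIr A (S1 :|: S2)).
  by have [le_U _] := leq_card_setU S1 S2; lia.
rewrite !inE => /andP[+ aA]; rewrite aA /= negb_or -!leqNgt => /andP[c1 c2].
have [||b [d [+ + E3bd]]] := rob3 _ _ _ _ c1 c2.
- by apply/subsetP=> b; rewrite inE => /andP[].
- by apply/subsetP=> d; rewrite inE => /andP[].
by rewrite !inE => /andP[_ E1ab] /andP[_ E2ad]; exists a, b, d.
Qed.

Section Shrinking.

Variables (N : nat) (Q : finType) (src tgt : Q -> 'I_N) (E : Q -> rel T).
Variable tau : nat -> nat.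
Hypothesis tau_mono : forall k, tau k <= tau k.+1.

Implicit Type F : 'I_N -> {set T}.

(** The condition [src q < tgt q] makes the two parts distinct, so that each can be shrunk on its
    own. *)
Definition live F q :=
  (src q < tgt q) &&
  [exists a in F (src q), exists b in F (tgt q), E q a b].

(* A live relation that is not robust is killed by passing to a large pair of
   subsets that it does not join, so the procedure stops after [#|Q|] steps. *)
Lemma shrink_to_robust k F :
  #|[set q | live F q]| <= k -> (forall i, tau k.+1 <= #|F i|) ->
  exists k' F', (forall i, tau k'.+1 <= #|F' i|) /\
    forall q, live F' q -> robust (tau k') (F' (src q)) (F' (tgt q)) (E q).
Proof.
elim: k F => [|k IH] F le_live cF.
  exists 0, F; split=> // q qF; move: le_live; rewrite leqn0 cards_eq0.
  by move/eqP/setP/(_ q); rewrite !inE qF.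
have [/forallP rob|] := boolP [forall q,
    live F q ==> robust (tau k.+1) (F (src q)) (F (tgt q)) (E q)].
  by exists k.+1, F; split=> // q; apply/implyP.
case/forallPn=> q; rewrite negb_imply => /andP[qF /forallPn[A' /forallPn[B']]].
rewrite negb_imply => /andP[/and4P[sA sB cA cB] noE].
have /andP[lt_q _] := qF.
(* Robustness fails at threshold [tau k.+1], exactly the part size that the induction hypothesis
   requires. *)
pose F' i := if i == src q then A' else if i == tgt q then B' else F i.
have sF i : F' i \subset F i.
  by rewrite /F'; do 2![case: eqP => [->//|_]].
have Fsrc : F' (src q) = A' by rewrite /F' eqxx.
have Ftgt : F' (tgt q) = B'.
  by rewrite /F' eqxx -(inj_eq val_inj) gtn_eqF.
apply: (IH F'); last first.
  move=> i; rewrite /F'; do 2![case: ifP => // _].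
  exact: leq_trans (tau_mono _) (cF i).
rewrite -ltnS; apply: leq_trans le_live; apply: proper_card.
apply/properP; split; last first.
  by exists q; rewrite !inE // /live Fsrc Ftgt negb_and noE orbT.
apply/subsetP=> p; rewrite !inE => /andP[lt_p /exists_inP[a aF]].
case/exists_inP=> b bF Eab; rewrite /live lt_p /=.
apply/exists_inP; exists a; first exact: subsetP (sF _) _ aF.
by apply/exists_inP; exists b => //; apply: subsetP (sF _) _ bF.
Qed.

End Shrinking.
End Robust.

(** * Uniform labels from genericity, shrinking and Ramsey *)

Lemma generic_blowup (C S : finType) (s0 : S) : 0 < #|C| ->
  exists N M (g : 'I_M -> 'I_M -> C),
  forall chi : 'I_N * 'I_M -> 'I_N * 'I_M -> S,
  exists f : C -> S, forall x y z, exists (i j k : 'I_N) (a b d : 'I_M),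
    [/\ i < j < k, (g a b, g a d, g b d) = (x, y, z) &
        (chi (i, a) (j, b), chi (i, a) (k, d), chi (j, b) (k, d))
        = (f x, f y, f z)].
Proof.
move=> C_gt0; have [N ramsey] := ramsey_triangle {ffun C -> S}.
pose Q := ('I_N * 'I_N * C * S)%type.
(* The exponent makes [M] one more than [tau #|{: Q}|.+1], so full parts are large enough to start
   shrinking. *)
have [t t_gt0 [g gP]] := generic_matrix (2 ^ #|{: Q}|.+1) C_gt0.
exists N, (t.+1 ^ 2 ^ #|{: Q}|.+1), g; set M := t.+1 ^ _ in g gP * => chi.
(* chosen so that [tau k.+1 = tau k * tau k + 2 * tau k] *)
pose tau k := (t.+1 ^ 2 ^ k).-1.
have tauS k : tau k.+1 = tau k * tau k + 2 * tau k.
  rewrite /tau expnS mulnC expnM -mulnn.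
  have : 0 < t.+1 ^ 2 ^ k by rewrite expn_gt0.
  by case: (t.+1 ^ 2 ^ k) => //= n _; lia.
have tau_mono k : tau k <= tau k.+1 by rewrite tauS; nia.
have tau_ge k : t <= tau k.
  by elim: k => [|k IH]; [rewrite /tau expn0 expn1 | apply: leq_trans (tau_mono _)].
pose src (q : Q) := q.1.1.1; pose tgt (q : Q) := q.1.1.2.
pose E (q : Q) : rel 'I_M := fun a b =>
  (g a b == q.1.2) && (chi (src q, a) (tgt q, b) == q.2).
have [||k [F [cF robF]]] := @shrink_to_robust _ N Q src tgt E tau tau_mono
    #|{: Q}| (fun=> setT).
- exact: max_card.
- by move=> i; rewrite cardsT card_ord /tau; apply: leq_pred.
have cFt i : t <= #|F i| by apply: leq_trans (cF i).
pose rob i j x s := robust (tau k) (F i) (F j) (E (i, j, x, s)).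
(* The matrix still has a pair of color [x] between the shrunken parts; the label of that pair gives
   a live, hence robust, relation. *)
have rob_ex (i j : 'I_N) x : i < j -> exists s, rob i j x s.
  move=> lt_ij; have [a [b [aF bF gab]]] := gP (F i) (F j) x (cFt i) (cFt j).
  exists (chi (i, a) (j, b)); apply: (robF (i, j, x, _)); rewrite /live lt_ij.
  apply/exists_inP; exists a => //; apply/exists_inP; exists b => //.
  by rewrite /E gab !eqxx.
(* By [rob_ex], the default [s0] is never reached for [i < j]. *)
pose ph i j := [ffun x => odflt s0 [pick s | rob i j x s]].
have phP (i j : 'I_N) x : i < j -> rob i j x (ph i j x).
  move=> lt_ij; rewrite ffunE; case: pickP => //= none.
  by have [s] := rob_ex i j x lt_ij; rewrite none.
have [i [j [l [lt_ij lt_jl eq1 eq2]]]] := ramsey ph.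
exists (ph i j) => x y z; have lt_il := ltn_trans lt_ij lt_jl.
have := phP i l y lt_il; have := phP j l z lt_jl; have := phP i j x lt_ij.
rewrite -eq2 -eq1 => rob1 rob3 rob2.
have tk := leq_trans t_gt0 (tau_ge k).
have [|||a [b [d [E1 E2 E3]]]] := robust_triangle rob1 rob2 rob3 tk.
- by apply: leq_trans (cF i); rewrite tauS leq_addl.
- by apply: leq_trans (cF j); rewrite tauS; lia.
- by apply: leq_trans (cF l); rewrite tauS; lia.
exists i, j, l, a, b, d; rewrite lt_ij lt_jl.
by case/andP: E1 => /eqP-> /eqP->; case/andP: E2 => /eqP-> /eqP->;
   case/andP: E3 => /eqP-> /eqP->.
Qed.

(** * Transfer of colorings along homomorphisms and reversal *)

Lemma linear_order_dual (T : eqType) (le : rel T) :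
  linear_order le -> linear_order (fun u v => le v u).
Proof.
case=> lexx anti trans total; split=> [x|x y|y x z le_yx le_zy|x y].
- exact: lexx.
- by rewrite andbC; apply: anti.
- exact: trans le_zy le_yx.
- exact: total.
Qed.

Lemma set3_rev (T : finType) (u v w : T) : [set w; v; u] = [set u; v; w].
Proof. by rewrite setUC (setUC [set w]) setUA. Qed.

Lemma colorable_hom (P P0 : palette) (H : hypergraph) :
  has_hom P P0 -> colorable P H -> colorable P0 H.
Proof.
case=> f hom_f [le [c [lin cP]]]; exists le, (f \o c); split=> // u v w e uv vw.
by apply: hom_f; apply: cP.
Qed.

Lemma colorable_inv (P : palette) (H : hypergraph) :
  colorable (inv_palette P) H -> colorable P H.
Proof.
case=> le [c [lin cP]]; exists (fun u v => le v u), c.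
split=> [|u v w e]; first exact: linear_order_dual.
rewrite /strict (eq_sym u v) (eq_sym v w) => uv vw.
have := cP w v u; rewrite set3_rev inE (setUC [set w] [set v]).
by rewrite (setUC [set w] [set u]) (setUC [set v] [set u]); apply.
Qed.

(** * The hypergraph of feasible triangles *)

Section Blowup.

Variables (P : palette) (N M : nat) (g : 'I_M -> 'I_M -> color P).
Let V : finType := ('I_N * 'I_M)%type.

Definition blowup_triangle (p : V * V * V) :=
  [&& p.1.1.1 < p.1.2.1, p.1.2.1 < p.2.1 &
      (g p.1.1.2 p.1.2.2, g p.1.1.2 p.2.2, g p.1.2.2 p.2.2) \in feasible P].

Definition blowup_edges : {set {set V}} :=
  [set [set p.1.1; p.1.2; p.2] | p : V * V * V & blowup_triangle p].

Lemma blowup_edges_3uniform e : e \in blowup_edges -> #|e| = 3.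
Proof.
case/imsetP=> -[[u v] w]; rewrite inE => /and3P[/= uv vw _] ->.
have neq (x y : V) : x.1 < y.1 -> x != y by apply: contraTneq => ->; rewrite ltnn.
rewrite -setUA !cardsU1 cards1 !inE negb_or !neq //.
exact: ltn_trans vw.
Qed.

Definition blowup := Hypergraph blowup_edges_3uniform.

Definition lex (u v : V) := (u.1 < v.1) || (u.1 == v.1) && (u.2 <= v.2).

Lemma lex_linear : linear_order lex.
Proof.
split.
- by move=> u; rewrite /lex eqxx leqnn orbT.
- case=> [i a] [j b] /andP[]; rewrite /lex /= -!(inj_eq val_inj) /= => l1 l2.
  by congr (_, _); apply: val_inj => /=; lia.
- case=> [j b] [i a] [k d]; rewrite /lex /= -!(inj_eq val_inj) /=; lia.
- case=> [i a] [j b]; rewrite /lex /= -!(inj_eq val_inj) /=; lia.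
Qed.

Lemma blowup_colorable : colorable P blowup.
Proof.
have /card_gt0P[x0 _] := color_nonempty P.
(* The order of the parts recovers the orientation of an unordered pair; pairs within one part get
   the default [x0]. *)
pose c (e : {set V}) :=
  if [pick p : V * V | (p.1.1 < p.2.1) && (e == [set p.1; p.2])] is Some p
  then g p.1.2 p.2.2 else x0.
have cE (u v : V) : u.1 < v.1 -> c [set u; v] = g u.2 v.2.
  move=> lt_uv; rewrite /c; case: pickP => [[u' v'] /= /andP[lt /eqP e]|].
    have : u' \in [set u; v] by rewrite e !inE eqxx.
    have : v' \in [set u; v] by rewrite e !inE eqxx orbT.
    rewrite !inE => /orP[] /eqP ev /orP[] /eqP eu;
      move: lt; rewrite ev eu ?ltnn // ltnNge => /negP[]; exact: ltnW.
  by move/(_ (u, v)); rewrite /= lt_uv eqxx.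
exists lex, c; split=> [|u v w]; first exact: lex_linear.
case/imsetP=> -[[p q] r]; rewrite inE => /and3P[/= pq qr T] e.
rewrite /strict => /andP[neq_uv uv] /andP[neq_vw vw].
(* As sets, [u, v, w] are [p, q, r] in some order; distinctness and the weak order of the parts
   leave only the identity. *)
have mem x : x \in [set u; v; w] -> [\/ x = p, x = q | x = r].
  rewrite e !inE -orbA => /or3P[] /eqP ->.
  - exact: Or31. - exact: Or32. - exact: Or33.
have {uv}uv : u.1 <= v.1 by case/orP: uv => [/ltnW //|/andP[/eqP ->]].
have {vw}vw : v.1 <= w.1 by case/orP: vw => [/ltnW //|/andP[/eqP ->]].
have pr := ltn_trans pq qr.
have [-> -> ->] : [/\ u = p, v = q & w = r].
  have := mem u; have := mem v; have := mem w; rewrite !inE !eqxx !orbT /=.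
  case/(_ isT)=> ew /(_ isT) [] ev /(_ isT) [] eu; 
    rewrite eu ev ew {e mem eu ev ew} in uv vw neq_uv neq_vw *; split=> //;
    by [ rewrite eqxx in neq_uv | rewrite eqxx in neq_vw
       | rewrite leqNgt ?pq ?qr ?pr in uv | rewrite leqNgt ?pq ?qr ?pr in vw ].
by rewrite !cE.
Qed.

Lemma blowup_edge (i j k : 'I_N) (a b d : 'I_M) :
  i < j < k -> (g a b, g a d, g b d) \in feasible P ->
  [set (i, a); (j, b); (k, d)] \in blowup_edges.
Proof.
case/andP=> ij jk T; apply/imsetP; exists ((i, a), (j, b), (k, d)) => //.
by rewrite inE /blowup_triangle /= ij jk.
Qed.

End Blowup.

Theorem theorem4p3 (P P0 : palette) :
  (exists H : hypergraph, colorable P H /\ ~ colorable P0 H) <->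
  (~ has_hom P P0 /\ ~ has_hom P (inv_palette P0)).
Proof.
split=> [[H [colP ncolP0]]|[no_hom no_inv]].
  split=> hom; apply: ncolP0; first exact: colorable_hom colP.
  by apply: colorable_inv; apply: colorable_hom colP.
have /card_gt0P[s0 _] := color_nonempty P0.
have /card_gt0P[x0 _] := color_nonempty P.
have [N [M [g gP]]] := generic_blowup (s0, true) (color_nonempty P).
exists (blowup N g); split; first exact: blowup_colorable.
case=> le [c [[lexx anti trans total] cP]].
have {gP}[f fP] := gP (fun u v => (c [set u; v], le u v)).
have fst_neq (i j : 'I_N) (a b : 'I_M) : i < j -> (i, a) != (j, b).
  by apply: contraTneq => -[-> _]; rewrite ltnn.
have nle u v : u != v -> le u v = false -> strict le v u.
  move=> neq nuv; rewrite /strict eq_sym neq /=.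
  by have := total u v; rewrite nuv.
(* A triangle whose two short sides have colour [x] and whose long side has
   colour [y] forces, by transitivity, the same direction for [x] and [y]. *)
have dir_const x y : (f x).2 = (f y).2.
  have [i [j [k [a [b [d [/andP[ij jk] _ []]]]]]]] := fP x y x.
  move=> e1 e2 e3; have := congr1 snd e1; have := congr1 snd e2.
  have := congr1 snd e3 => /= <- <- e4; case E: (le (j, b) (k, d)) in e4 *.
    by rewrite (trans (j, b)).
  have /andP[_ kj] := nle _ _ (fst_neq _ _ b d jk) E.
  have /andP[_ ji] := nle _ _ (fst_neq _ _ a b ij) e4.
  apply/esym/negP => ik; have := fst_neq _ _ a d (ltn_trans ij jk).
  by rewrite (anti (i, a) (k, d)) ?eqxx // ik (trans _ _ _ kj ji).
case dir: (f x0).2.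
  (* All directions agree with the parts, so [cP] reads each triangle forwards. *)
  apply: no_hom; exists (fun x => (f x).1) => x y z T.
  have [i [j [k [a [b [d [lt gE []]]]]]]] := fP x y z.
  have /andP[ij jk] := lt; rewrite -gE in T.
  move=> e1 e2 e3; have /= d1 := congr1 snd e1; have /= d3 := congr1 snd e3.
  rewrite -e1 -e2 -e3 /=; apply: cP.
  - exact: blowup_edge.
  - by rewrite /strict fst_neq //= d1 (dir_const _ x0).
  - by rewrite /strict fst_neq //= d3 (dir_const _ x0).
(* All directions are reversed, so [cP] reads each triangle backwards and yields the reversed
   triple. *)
apply: no_inv; exists (fun x => (f x).1) => x y z T.
have [i [j [k [a [b [d [lt gE []]]]]]]] := fP x y z.
have /andP[ij jk] := lt; rewrite -gE in T.
move=> e1 e2 e3; have /= d1 := congr1 snd e1; have /= d3 := congr1 snd e3.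
rewrite inE -e1 -e2 -e3 /=.
rewrite (setUC [set (i, a)]) (setUC [set (i, a)]) (setUC [set (j, b)]).
apply: cP.
- by rewrite set3_rev blowup_edge.
- apply: nle; first exact: fst_neq.
  by rewrite d3 (dir_const _ x0) dir.
- apply: nle; first exact: fst_neq.
  by rewrite d1 (dir_const _ x0) dir.
Qed.
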